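(* Consider the following assumptions. (A) (i) $\Theta,\Pi$ are compact; (ii) for every $\pi_1,\pi_2\in\Pi$, $\theta\in\Theta$ and $u\sim F_u$ there is a random value $A_n=O_p(1)$ such that, for $n$ sufficiently large, $\|\Phi_n(\theta,u,\pi_1)-\Phi_n(\theta,u,\pi_2)\|\le A_n\|\pi_1-\pi_2\|$; (iii) for every $\theta\in\Theta,\pi\in\Pi$, $\Phi_n(\theta,u,\pi)$ converges pointwise (in probability) to a deterministic $\Phi(\theta,\pi)$; (iv) for every $\theta\in\Theta$, $\pi_1,\pi_2\in\Pi$: $\Phi(\theta,\pi_1)=\Phi(\theta,\pi_2)$ if and only if $\pi_1=\pi_2$. (B) (i) for every $\theta_1,\theta_2\in\Theta$, $\pi\in\Pi$ and $u\sim F_u$ there is a random value $B_n=O_p(1)$ such that, for $n$ sufficiently large, $\|\Phi_n(\theta_1,u,\pi)-\Phi_n(\theta_2,u,\pi)\|\le B_n\|\theta_1-\theta_2\|$; (ii) for every $\theta_1,\theta_2\in\Theta$, $\pi\in\Pi$: $\Phi(\theta_1,\pi)=\Phi(\theta_2,\pi)$ if and only if $\theta_1=\theta_2$. (C) (i) for every $\theta_1,\theta_2\in\Theta$ there is a random value $C_n=O_p(1)$ such that, for $n$ sufficiently large, $\|\hat\pi_{\mathrm{II},n}(\theta_1)-\hat\pi_{\mathrm{II},n}(\theta_2)\|\le C_n\|\theta_1-\theta_2\|$; (ii) with $\pi(\theta)$ the mapping to which $\hat\pi_{\mathrm{II},n}(\theta)$ converges pointwise for every $\theta\in\Theta$,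 for every $\theta_1,\theta_2\in\Theta$: $\pi(\theta_1)=\pi(\theta_2)$ if and only if $\theta_1=\theta_2$. Then: 1. If (A) holds, any sequence $\{\hat\pi_n\}$ converges in probability to $\pi_0$, and, for any fixed $\theta\in\Theta$, any sequence $\{\hat\pi_{\mathrm{II},n}(\theta)\}$ converges in probability to $\pi(\theta)$. 2. If moreover (B) or (C) holds, any sequence $\{\hat\theta_n\}$ converges in probability to $\theta_0$.
   Context: Setting: $\Theta,\Pi\subset\mathbb{R}^p$ are parameter sets. Data are generated as $x=g(\theta,u)$, where $u$ follows a known distribution $F_u$ not depending on $\theta$. For an estimating function $\psi$ with values in $\mathbb{R}^p$, $\Phi_n(\theta,u,\pi)=\frac1n\sum_{i=1}^n\psi(g(\theta,u_i),\pi)$. $\theta_0\in\Theta$ is the true parameter, $u_0$ the realization of $u$ generating the observed sample, and $u_s$ ($s\ge1$) a simulated copy of $u$. Estimators: $\hat\pi_n$ is a zero in $\Pi$ of $\pi\mapsto\Phi_n(\theta_0,u_0,\pi)$; for fixed $\theta$, $\hat\pi_{\mathrm{II},n}(\theta)$ is a zero in $\Pi$ of $\pi\mapsto\Phi_n(\theta,u_s,\pi)$; $\hat\theta_n$ is either the SwiZs estimator, a zero in $\Theta$ of $\theta\mapsto\Phi_n(\theta,u_s,\hat\pi_n)$, or the indirect inference estimator, a zero in $\Theta$ of $\theta\mapsto d(\hat\pi_n,\hat\pi_{\mathrm{II},n}(\theta))$ with $d$ a metric (e.g. induced by a norm). (These two estimators coincide when the zeros in $\pi$ are unique.) $\pi(\theta)\in\Pi$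 denotes the zero of the limit, $\Phi(\theta,\pi(\theta))=0$, and $\pi_0=\pi(\theta_0)$. All the zeros referred to are assumed to exist.
   Formalization: The factors are uniform: A_n serves all π1, π2 at once, B_n all θ1, θ2, π, and C_n all θ1, θ2 (chosen pair by pair, the claim fails); for the SwiZs estimator, (C) is required of every family of zeros π̂_II,n(θ), not of just one. *)

(* Defs.v *)
From HB Require Import structures.
From mathcomp Require Import all_boot all_order all_algebra.
From mathcomp Require Import all_classical all_reals all_analysis.

Set Implicit Arguments.
Unset Strict Implicit.
Unset Printing Implicit Defensive.

Import Order.TTheory GRing.Theory Num.Theory.
Import numFieldNormedType.Exports.

Local Open Scope classical_set_scope.
Local Open Scope ring_scope.

(* MathComp-Analysis development.  R^p is 'rV[R]_p, with its library norm `|_|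
   (the sup norm; all norms on R^p are equivalent, and a change of norm only
   rescales the O_p(1) factors below). *)

(* Measurability for the Borel sigma-algebra of R^p, i.e. coordinatewise. *)
Definition vec_measurable (R : realType) (p : nat) (d : measure_display)
    (T : measurableType d) (f : T -> 'rV[R]_p) : Prop :=
  forall i : 'I_p, measurable_fun setT (fun t => f t ord0 i).

Definition cvg_in_prob (R : realType) (p : nat) (d : measure_display)
    (Omega : measurableType d) (P : probability Omega R)
    (Z : nat -> Omega -> 'rV[R]_p) (c : 'rV[R]_p) : Prop :=
  forall e : R, 0 < e -> P [set w | e <= `|Z n w - c|] @[n --> \oo] --> 0%E.

(* A_n = O_p(1) *)
Definition Op1 (R : realType) (d : measure_display) (Omega : measurableType d)
    (P : probability Omega R) (A : nat -> {RV P >-> R}) : Prop :=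
  forall e : R, 0 < e -> exists2 M : R, 0 < M &
    \forall n \near \oo, (P [set w | (M < `|A n w|)%R] <= e%:E)%E.

(* For sample size n the random input is u_n = (u_{n,1}, ..., u_{n,n}), with
   law F n on U^n; its coordinates need be neither independent nor identically
   distributed, and no relation between different n is imposed. *)
Definition has_law (R : realType) (dO dU : measure_display)
    (Omega : measurableType dO) (P : probability Omega R)
    (U : measurableType dU) (F : forall n, probability (n.-tuple U) R)
    (u : forall n, {RV P >-> n.-tuple U}) : Prop :=
  forall n (E : set (n.-tuple U)), measurable E ->
    distribution P (u n) E = F n E.

(* Phi_n(theta, u, pi) = 1/n sum_i psi(g(theta, u_i), pi) *)
Definition Phin (R : realType) (p : nat) (U X : Type)
    (g : 'rV[R]_p -> U -> X) (psi : X -> 'rV[R]_p -> 'rV[R]_p)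
    (n : nat) (theta : 'rV[R]_p) (u : n.-tuple U) (pi : 'rV[R]_p) : 'rV[R]_p :=
  n%:R^-1 *: \sum_(i < n) psi (g theta (tnth u i)) pi.

Definition zero_in (V : Type) (W : zmodType) (S : set V) (f : V -> W)
    (x : V) : Prop :=
  S x /\ f x = 0.

(* d is an arbitrary metric on R^p, unrelated to the norm. *)
Definition is_metric (R : realType) (p : nat)
    (d : 'rV[R]_p -> 'rV[R]_p -> R) : Prop :=
  [/\ forall x y, 0 <= d x y, forall x y, d x y = 0 <-> x = y,
      forall x y, d x y = d y x & forall x y z, d x z <= d x y + d y z].

Section Estimators.
Context (R : realType) (p : nat) (dO dU : measure_display)
  (Omega : measurableType dO) (P : probability Omega R)
  (U : measurableType dU) (X : Type).
Variables (g : 'rV[R]_p -> U -> X) (psi : X -> 'rV[R]_p -> 'rV[R]_p).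

(* A measurable zero in Pi of pi |-> Phi_n(theta, u, pi): with theta = theta_0
   and u = u_0 this is hat pi_n, with u = u_s it is hat pi_{II,n}(theta). *)
Definition pi_estimator (Pi : set 'rV[R]_p) (theta : 'rV[R]_p)
    (u : forall n, {RV P >-> n.-tuple U})
    (pihat : nat -> Omega -> 'rV[R]_p) : Prop :=
  forall n, vec_measurable (pihat n) /\
    ((0 < n)%N -> forall w, zero_in Pi (Phin g psi theta (u n w)) (pihat n w)).

Definition piII_estimator (Theta Pi : set 'rV[R]_p)
    (us : forall n, {RV P >-> n.-tuple U})
    (piII : nat -> 'rV[R]_p -> Omega -> 'rV[R]_p) : Prop :=
  forall theta, Theta theta -> pi_estimator Pi theta us (fun n => piII n theta).

Definition SwiZs_estimator (Theta : set 'rV[R]_p)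
    (us : forall n, {RV P >-> n.-tuple U})
    (pihat thetahat : nat -> Omega -> 'rV[R]_p) : Prop :=
  forall n, vec_measurable (thetahat n) /\
    ((0 < n)%N -> forall w,
       zero_in Theta (fun theta => Phin g psi theta (us n w) (pihat n w))
         (thetahat n w)).

Definition II_estimator (Theta : set 'rV[R]_p)
    (d : 'rV[R]_p -> 'rV[R]_p -> R)
    (pihat : nat -> Omega -> 'rV[R]_p)
    (piII : nat -> 'rV[R]_p -> Omega -> 'rV[R]_p)
    (thetahat : nat -> Omega -> 'rV[R]_p) : Prop :=
  forall n, vec_measurable (thetahat n) /\
    ((0 < n)%N -> forall w,
       zero_in Theta (fun theta => d (pihat n w) (piII n theta w))
         (thetahat n w)).

(* The Lipschitz factors A_n, B_n, C_n below are stochastic equicontinuity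
   constants: A_n serves all pi_1, pi_2 at once (it may depend on theta and u),
   B_n all theta_1, theta_2, pi (it may depend on u), C_n all theta_1, theta_2.
   A factor chosen pair by pair would carry no information, since under
   pointwise convergence each single difference quotient is O_p(1). *)

Definition assumption_A (F : forall n, probability (n.-tuple U) R)
    (Theta Pi : set 'rV[R]_p) (Phi : 'rV[R]_p -> 'rV[R]_p -> 'rV[R]_p) : Prop :=
  [/\ compact Theta /\ compact Pi,
      forall theta, Theta theta ->
        forall u : (forall n, {RV P >-> n.-tuple U}), has_law F u ->
        exists2 A : nat -> {RV P >-> R}, Op1 A &
          \forall n \near \oo, {ae P, forall w, forall pi1 pi2,
            Pi pi1 -> Pi pi2 ->
            `|Phin g psi theta (u n w) pi1 - Phin g psi theta (u n w) pi2|
              <= A n w * `|pi1 - pi2|},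
      forall theta pi, Theta theta -> Pi pi ->
        forall u : (forall n, {RV P >-> n.-tuple U}), has_law F u ->
        cvg_in_prob P (fun n w => Phin g psi theta (u n w) pi) (Phi theta pi) &
      forall theta pi1 pi2, Theta theta -> Pi pi1 -> Pi pi2 ->
        (Phi theta pi1 = Phi theta pi2 <-> pi1 = pi2)].

Definition assumption_B (F : forall n, probability (n.-tuple U) R)
    (Theta Pi : set 'rV[R]_p) (Phi : 'rV[R]_p -> 'rV[R]_p -> 'rV[R]_p) : Prop :=
  (forall u : (forall n, {RV P >-> n.-tuple U}), has_law F u ->
     exists2 B : nat -> {RV P >-> R}, Op1 B &
       \forall n \near \oo, {ae P, forall w, forall theta1 theta2 pi,
         Theta theta1 -> Theta theta2 -> Pi pi ->
         `|Phin g psi theta1 (u n w) pi - Phin g psi theta2 (u n w) pi|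
           <= B n w * `|theta1 - theta2|}) /\
  (forall theta1 theta2 pi, Theta theta1 -> Theta theta2 -> Pi pi ->
     (Phi theta1 pi = Phi theta2 pi <-> theta1 = theta2)).

(* pimap is theta |-> pi(theta), both the zero of the limit Phi(theta, .) and
   (under assumption_A) the pointwise limit in probability of piII. *)
Definition assumption_C (Theta : set 'rV[R]_p)
    (pimap : 'rV[R]_p -> 'rV[R]_p)
    (piII : nat -> 'rV[R]_p -> Omega -> 'rV[R]_p) : Prop :=
  (exists2 C : nat -> {RV P >-> R}, Op1 C &
     \forall n \near \oo, {ae P, forall w, forall theta1 theta2,
       Theta theta1 -> Theta theta2 ->
       `|piII n theta1 w - piII n theta2 w| <= C n w * `|theta1 - theta2|}) /\
  (forall theta1 theta2, Theta theta1 -> Theta theta2 ->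
     (pimap theta1 = pimap theta2 <-> theta1 = theta2)).

End Estimators.

(* Main.v *)
Require Import Defs.
From HB Require Import structures.
From mathcomp Require Import all_boot all_order all_algebra.
From mathcomp Require Import all_classical all_reals all_analysis.
From mathcomp Require Import ring lra.

Set Implicit Arguments.
Unset Strict Implicit.

Import Order.TTheory GRing.Theory Num.Theory.
Import numFieldNormedType.Exports.
Local Open Scope classical_set_scope.
Local Open Scope ring_scope.

(* Call an event on the pairs (n, w) likely when its complement has probability
   tending to 0 with n.  Likely events form a filter, convergence in probability
   is convergence along it, and O_p(1) means that a property is likely as soon
   as it is likely on each event {|A_n| <= M}.  All three estimators are then
   (approximate) zeros z of random maps G_n on a compact set, converging
   pointwise to a map with the single zero x0 and Lipschitz with O_p(1) factors.
   If G x != 0 then, on {L_n <= M}, a ball around x of radius comparable with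
   |G x| / M likely contains no approximate zero of G_n; finitely many such
   balls cover the complement of a given ball around x0.
   - pi estimators: G_n = Phi_n(theta, u_n, .);
   - SwiZs under (B): G_n = Phi_n(., u_n, pi_0), for which thetahat is an
     approximate zero since Phi_n(., u_n, pihat_n) - Phi_n(., u_n, pi_0)
     converges uniformly to 0;
   - indirect inference under (C): G_n = piII_n - pi_0;
   - the two remaining cases follow from pihat_n = piII_n(thetahat_n), which for
     SwiZs holds after modifying piII at the single point thetahat_n. *)

(** * Approximate zeros of Lipschitz maps along an arbitrary filter *)

Definition tight {R : realType} {I : Type} (F : set_system I) (L : I -> R) :
    Prop :=
  forall Q : set I,
    (forall M, 0 < M -> \forall i \near F, `|L i| <= M -> Q i) ->
    \forall i \near F, Q i.

(** This plays the role of a finite subcover: each [x] in [S] brings a neighbourhood and a member of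
    [F] on which [Q] holds jointly. *)
Lemma compact_near_forall (T : topologicalType) (S : set T) (I : Type)
    (F : set_system I) {FF : Filter F} (Q : I -> T -> Prop) :
  compact S ->
  (forall x, S x -> \forall y \near x & i \near F, S y -> Q i y) ->
  \forall i \near F, forall x, S x -> Q i x.
Proof.
by move=> /compact_near_coveringP/near_covering_withinP cS; exact: cS.
Qed.

Lemma tight_lipschitz_zero_cvg (R : realType) (V W : normedModType R)
    (I : Type) (F : set_system I) {FF : Filter F} (S : set V) (x0 : V)
    (G : V -> W) (Gn : I -> V -> W) (L : I -> R) (z : I -> V) :
  compact S -> (forall x, S x -> G x = 0 -> x = x0) -> tight F L ->
  (\forall i \near F, forall x y, S x -> S y ->
     `|Gn i x - Gn i y| <= L i * `|x - y|) ->
  (forall x, S x -> Gn^~ x @ F --> G x) ->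
  (\forall i \near F, S (z i)) -> Gn i (z i) @[i --> F] --> (0 : W) ->
  z @ F --> x0.
Proof.
move=> cS G0 tL lip GnG Sz Gz; apply/cvgrPdist_lt => e e0.
apply: tL => M M0.
(* Quantifying over all [x] with [z i = x] trades the moving point [z i] for fixed ones, so that
   compactness of [S] applies; at the end [x] is taken to be [z i]. *)
have : \forall i \near F, forall x, S x -> `|L i| <= M -> z i = x ->
    `|x0 - x| < e.
  apply: compact_near_forall => // x Sx.
  have [xx0|xx0] := eqVneq x x0.
    exists ([set y | `|x - y| < e], setT) => /=.
      by split; [exact: cvgr_dist_lt | exact: filterT].
    by case=> y i /= [+ _] _ _ _; rewrite xx0.
  have Gx0 : 0 < `|G x|.
    by rewrite normr_gt0; apply: contra_neq xx0; exact: G0.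
  (* If [z i = y] lay in the ball of this radius, each of $|G x - G_n x|$, $|G_n x - G_n y|$ and
     $|G_n y|$ would be at most $|G x|/4$, which forces $|G x| \le 3|G x|/4$. *)
  have r0 : 0 < `|G x| / (4 * M) by rewrite divr_gt0// mulr_gt0.
  have q0 : 0 < `|G x| / 4 by rewrite divr_gt0.
  exists ([set y | `|x - y| < `|G x| / (4 * M)],
    [set i | [/\ `|G x - Gn i x| < `|G x| / 4, `|Gn i (z i)| < `|G x| / 4 &
      forall y, S y -> `|Gn i x - Gn i y| <= L i * `|x - y|]]) => /=.
    split; first exact: cvgr_dist_lt.
    have Gnx : \forall i \near F, `|G x - Gn i x| < `|G x| / 4.
      by move/cvgrPdist_lt: (GnG _ Sx); exact.
    have Gnz : \forall i \near F, `|Gn i (z i)| < `|G x| / 4.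
      by move/cvgr0_norm_lt: Gz; exact.
    by apply: filterS3 Gnx Gnz lip => i ? ? lipi; split=> // y; exact: lipi.
  case=> y i /= [yx [Gnx Gny lipxy]] Sy LM zy; exfalso.
  rewrite zy in Gny; have := lipxy _ Sy.
  have : L i * `|x - y| <= `|G x| / 4.
    rewrite (_ : _ / 4 = M * (`|G x| / (4 * M))); last by field; rewrite gt_eqF.
    apply: (le_trans (ler_wpM2r (normr_ge0 _) (le_trans (ler_norm _) LM))).
    by rewrite ler_pM2l// ltW.
  have := ler_distD (Gn i x) (G x) 0.
  have := ler_distD (Gn i y) (Gn i x) 0.
  rewrite !subr0; lra.
move=> c; near=> i => LM.
have zi : S (z i) by near: i.
by have /(_ _ zi LM erefl) : forall x, S x -> `|L i| <= M -> z i = x ->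
    `|x0 - x| < e by near: i.
Unshelve. all: end_near.
Qed.

(** * Measurability of norms and of [Phin] *)

Lemma measurable_bigmaxr (R : realType) (d : measure_display)
    (T : measurableType d) (D : set T) (I : Type) (s : seq I)
    (h : I -> T -> R) :
  (forall i, measurable_fun D (h i)) ->
  measurable_fun D (fun t => \big[Num.max/0]_(i <- s) h i t).
Proof.
move=> mh; elim: s => [|i s IHs].
  by under eq_fun do rewrite big_nil; exact: measurable_cst.
by under eq_fun do rewrite big_cons; exact: measurable_realfun.measurable_maxr.
Qed.

Lemma vec_measurable_norm (R : realType) (p : nat) (d : measure_display)
    (T : measurableType d) (f : T -> 'rV[R]_p) :
  vec_measurable f -> measurable_fun setT (fun t => `|f t|).
Proof.
move=> mf; under eq_fun do rewrite /Num.norm /= mx_normrE.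
apply: measurable_bigmaxr => -[i j] /=; rewrite ord1.
exact: measurableT_comp.
Qed.

Lemma vec_measurable_subC (R : realType) (p : nat) (d : measure_display)
    (T : measurableType d) (f : T -> 'rV[R]_p) (c : 'rV[R]_p) :
  vec_measurable f -> vec_measurable (fun t => f t - c).
Proof.
move=> mf i; under eq_fun do rewrite !mxE.
apply: measurable_realfun.measurable_funB; [exact: mf | exact: measurable_cst].
Qed.

Lemma vec_measurable_Phin (R : realType) (p : nat) (dO dU dX : measure_display)
    (Omega : measurableType dO) (U : measurableType dU) (X : measurableType dX)
    (P : probability Omega R) (g : 'rV[R]_p -> U -> X)
    (psi : X -> 'rV[R]_p -> 'rV[R]_p) (theta pi : 'rV[R]_p) (n : nat)
    (u : {RV P >-> n.-tuple U}) :
  measurable_fun setT (g theta) -> vec_measurable (fun x => psi x pi) ->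
  vec_measurable (fun w => Phin g psi theta (u w) pi).
Proof.
move=> mg mpsi k; rewrite /Phin.
under eq_fun do rewrite mxE summxE.
apply: measurable_realfun.measurable_funM; first exact: measurable_cst.
apply: measurable_sum => i; apply: (measurableT_comp (mpsi k)).
apply: (measurableT_comp mg); apply: (measurableT_comp (measurable_tnth i)).
exact: measurable_funPT.
Qed.

(** * Likely events and convergence along their filter *)

Lemma probability_cvg0P (R : realType) (d : measure_display)
    (T : measurableType d) (P : probability T R) (E : nat -> set T) :
  (forall n, measurable (E n)) ->
  P (E n) @[n --> \oo] --> 0%E <->
  forall e : R, 0 < e -> \forall n \near \oo, (P (E n) <= e%:E)%E.
Proof.
move=> mE; have fE n : P (E n) \is a fin_num by exact: fin_num_measure.
have fineE e n : (P (E n) <= e%:E)%E = (`|fine (P (E n))| <= e).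
  by rewrite ger0_norm ?fine_ge0 -?lee_fin ?fineK.
split=> [/fine_cvgP[_ /cvgr0Pnorm_le E0] e e0|E0].
  by apply: filterS (E0 e e0) => n; rewrite fineE.
apply/fine_cvgP; split; first exact: nearW.
by apply/cvgr0Pnorm_le => e e0; apply: filterS (E0 e e0) => n; rewrite fineE.
Qed.

(* A Variant rather than a product type, so that `apply: filterS` does not see
   through it. *)
Variant with_high_prob {R : realType} {d : measure_display}
    {T : measurableType d} (P : probability T R) (Q : set (nat * T)) : Prop :=
  WithHighProb of forall e : R, 0 < e -> \forall n \near \oo,
    exists2 B : set T, measurable B /\ (P B <= e%:E)%E &
      forall w, ~ B w -> Q (n, w).

(** Failures are only covered by a measurable [B], so [Q] may be any property, such as a Lipschitz
    bound quantified over uncountably many points. *)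
Definition prob_near {R : realType} {d : measure_display}
    {T : measurableType d} (P : probability T R) : set_system (nat * T) :=
  with_high_prob P.

Global Instance prob_near_filter (R : realType) (d : measure_display)
  (T : measurableType d) (P : probability T R) : Filter (prob_near P).
Proof.
split=> [|Q1 Q2 [FQ1] [FQ2]|Q1 Q2 Q12 [FQ1]]; constructor=> e e0.
- by apply: nearW => n; exists set0 => //; rewrite measure0 lee_fin ltW.
- have e20 : 0 < e / 2 by rewrite divr_gt0.
  apply: filterS2 (FQ1 _ e20) (FQ2 _ e20) => n [B1 [mB1 PB1] BQ1].
  move=> [B2 [mB2 PB2] BQ2]; exists (B1 `|` B2).
    split; first exact: measurableU.
    by rewrite (le_trans (measureU2 _ _ _))// (splitr e) EFinD leeD.
  by move=> w /not_orP[nB1 nB2]; split; [exact: BQ1 | exact: BQ2].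
- apply: filterS (FQ1 e e0) => n [B mPB BQ1]; exists B => // w nBw.
  by apply: Q12; exact: BQ1.
Qed.

(** A measurable bad event serves as its own cover; conversely, monotonicity bounds it by any
    cover. *)
Lemma prob_nearP (R : realType) (d : measure_display) (T : measurableType d)
    (P : probability T R) (Q : nat -> set T) :
  (forall n, measurable (~` Q n)) ->
  (\forall x \near prob_near P, Q x.1 x.2) <->
  P (~` Q n) @[n --> \oo] --> 0%E.
Proof.
move=> mQ; rewrite probability_cvg0P//.
split=> [[FQ] e e0|FQ]; last constructor=> e e0.
  apply: filterS (FQ e e0) => n [B [mB PB] BQ]; apply: le_trans PB.
  apply: le_measure; rewrite ?inE//.
  by move=> w nQ; apply: contrapT => /BQ.
by apply: filterS (FQ e e0) => n PQ; exists (~` Q n) => // w /contrapT.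
Qed.

Lemma cvg_in_probP (R : realType) (p : nat) (d : measure_display)
    (T : measurableType d) (P : probability T R) (Z : nat -> T -> 'rV[R]_p)
    (c : 'rV[R]_p) :
  (forall n, vec_measurable (Z n)) ->
  cvg_in_prob P Z c <-> Z x.1 x.2 @[x --> prob_near P] --> c.
Proof.
move=> mZ.
(* The complement of the strict inequality is exactly the event of [cvg_in_prob], so both sides use
   the same [e]. *)
have nearE e : (\forall x \near prob_near P, `|c - Z x.1 x.2| < e) <->
    P [set w | e <= `|Z n w - c|] @[n --> \oo] --> 0%E.
  have -> : (fun n => P [set w | e <= `|Z n w - c|]) =
      (fun n => P (~` [set w | `|c - Z n w| < e])).
    apply/funext => n; congr (P _); apply/seteqP.
    by split=> w /=; rewrite distrC leNgt => /negP.
  apply: prob_nearP => n; apply: measurableC.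
  have mn : measurable_fun setT (fun w => `|Z n w - c|).
    exact/vec_measurable_norm/vec_measurable_subC.
  under eq_set do rewrite distrC.
  rewrite -[X in measurable X]setTI -preimage_itvNyo.
  by apply: mn => //; exact: measurable_itv.
split=> [PZ|FZ e e0].
  by apply/cvgrPdist_lt => e e0; apply/nearE; exact: PZ.
by apply/nearE; move/cvgrPdist_lt: FZ; exact.
Qed.

(** With [M] chosen for [e / 2], the exceptional set is the event that $|A_n|$ exceeds [M], together
    with a cover of the failures of [Q] where $|A_n| \le M$. *)
Lemma Op1_tight (R : realType) (d : measure_display) (T : measurableType d)
    (P : probability T R) (A : nat -> {RV P >-> R}) :
  Op1 A -> tight (prob_near P) (fun x : nat * T => A x.1 x.2).
Proof.
move=> OA Q AQ; constructor=> e e0.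
have e20 : 0 < e / 2 by rewrite divr_gt0.
have [M M0 PA] := OA _ e20.
have [AQM] := AQ M M0.
apply: filterS2 PA (AQM _ e20) => n PAn [B [mB PB] BQ].
exists ([set w | M < `|A n w|] `|` B).
  have mA : measurable [set w | M < `|A n w|].
    rewrite -[X in measurable X]setTI -preimage_itvoy.
    have : measurable_fun setT (fun w => `|A n w|) by exact: measurableT_comp.
    by apply => //; exact: measurable_itv.
  split; first exact: measurableU.
  by rewrite (le_trans (measureU2 _ _ _))// (splitr e) EFinD leeD.
by move=> w /not_orP[/negP]; rewrite -leNgt => AM nB; exact: BQ.
Qed.

Lemma ae_prob_near (R : realType) (d : measure_display) (T : measurableType d)
    (P : probability T R) (Q : nat -> set T) :
  (\forall n \near \oo, {ae P, forall w, Q n w}) ->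
  \forall x \near prob_near P, Q x.1 x.2.
Proof.
move=> aeQ; constructor=> e e0; apply: filterS aeQ => n [B [mB PB0 QB]].
exists B; first by rewrite PB0 lee_fin ltW.
by move=> w nB; apply: contrapT => /QB.
Qed.

Lemma eventually_prob_near (R : realType) (d : measure_display)
    (T : measurableType d) (P : probability T R) (Q : nat -> set T) :
  (\forall n \near \oo, forall w, Q n w) ->
  \forall x \near prob_near P, Q x.1 x.2.
Proof.
by move=> Qn; apply: ae_prob_near; apply: filterS Qn => n Qn; exact: aeW.
Qed.

(** * Vanishing products and uniform convergence with tight factors *)

(** This is $O_p(1)\,o_p(1) = o_p(1)$ for a general filter: where $|L| \le M$, it suffices that $|r|
    < e/M$. *)
Lemma tight_mul_cvg0 (R : realType) (V W : normedModType R) (I : Type)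
    (F : set_system I) {FF : Filter F} (L : I -> R) (f : I -> W) (r : I -> V) :
  tight F L -> r i @[i --> F] --> (0 : V) ->
  (\forall i \near F, `|f i| <= L i * `|r i|) -> f i @[i --> F] --> (0 : W).
Proof.
move=> tL r0 fLr; apply/cvgr0Pnorm_lt => e e0; apply: tL => M M0.
have eM0 : 0 < e / M by rewrite divr_gt0.
have rM : \forall i \near F, `|r i| < e / M.
  by move/cvgr0_norm_lt: r0; exact.
apply: filterS2 fLr rM => i fi ri LM; apply: le_lt_trans fi _.
apply: (le_lt_trans (ler_wpM2r (normr_ge0 _) (le_trans (ler_norm _) LM))).
by rewrite mulrC -ltr_pdivlMr.
Qed.

(* The factors A x may be unrelated for different x: equicontinuity in x reduces
   the supremum over S to finitely many of them. *)
Lemma tight_lipschitz_cvg_uniform (R : realType) (V V' W : normedModType R)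
    (I : Type) (F : set_system I) {FF : Filter F} (S : set V) (T : set V')
    (H : I -> V -> V' -> W) (A : V -> I -> R) (B : I -> R) (q : I -> V')
    (q0 : V') :
  compact S -> (forall x, S x -> tight F (A x)) -> tight F B ->
  (forall x, S x -> \forall i \near F, forall y z, T y -> T z ->
     `|H i x y - H i x z| <= A x i * `|y - z|) ->
  (\forall i \near F, forall x x' y, S x -> S x' -> T y ->
     `|H i x y - H i x' y| <= B i * `|x - x'|) ->
  T q0 -> (\forall i \near F, T (q i)) -> q @ F --> q0 ->
  forall e, 0 < e ->
  \forall i \near F, forall x, S x -> `|H i x (q i) - H i x q0| < e.
Proof.
move=> cS tA tB lipA lipB Tq0 Tq qq0 e e0; apply: tB => M M0.
have : \forall i \near F, forall x, S x -> `|B i| <= M ->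
    `|H i x (q i) - H i x q0| < e.
  apply: compact_near_forall => // x Sx.
  have e20 : 0 < e / 2 by rewrite divr_gt0.
  (* Moving from [x] to a nearby [y] costs at most [e / 4] at [q i] and again at [q0]; the remaining
     [e / 2] is spent at the centre [x], where the factor [A x] controls the difference. *)
  have r0 : 0 < e / (4 * M) by rewrite divr_gt0// mulr_gt0.
  have Hx : \forall i \near F, `|H i x (q i) - H i x q0| < e / 2.
    suff /cvgr0_norm_lt : H i x (q i) - H i x q0 @[i --> F] --> (0 : W).
      by exact.
    apply: (@tight_mul_cvg0 _ _ _ _ _ _ (A x) _ (fun i => q i - q0)).
    - exact: tA.
    - exact/subr_cvg0.
    - by apply: filterS2 (lipA _ Sx) Tq => i lip Tqi; exact: lip.
  exists ([set y | `|x - y| < e / (4 * M)],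
    [set i | [/\ `|H i x (q i) - H i x q0| < e / 2, T (q i) &
      forall x x' y, S x -> S x' -> T y ->
        `|H i x y - H i x' y| <= B i * `|x - x'|]]) => /=.
    split; first exact: cvgr_dist_lt.
    by apply: filterS3 Hx Tq lipB => i ? ? ?; split.
  case=> y i /= [yx [Hxi Tqi lip]] Sy BM.
  have Br : B i * `|x - y| <= e / 4.
    rewrite (_ : e / 4 = M * (e / (4 * M))); last by field; rewrite gt_eqF.
    apply: (le_trans (ler_wpM2r (normr_ge0 _) (le_trans (ler_norm _) BM))).
    by rewrite ler_pM2l// ltW.
  have l1 := le_trans (lip _ _ _ Sx Sy Tqi) Br.
  have l2 := le_trans (lip _ _ _ Sx Sy Tq0) Br.
  have := ler_distD (H i x (q i)) (H i y (q i)) (H i y q0).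
  have := ler_distD (H i x q0) (H i x (q i)) (H i y q0).
  rewrite (distrC (H i y (q i)) (H i x (q i))); lra.
apply: filterS => i Hi BM x Sx; exact: Hi.
Qed.

(** * Consistency of the estimators *)

Lemma Phin_cvg (R : realType) (p : nat) (dO dU dX : measure_display)
    (Omega : measurableType dO) (U : measurableType dU) (X : measurableType dX)
    (P : probability Omega R) (F : forall n, probability (n.-tuple U) R)
    (g : 'rV[R]_p -> U -> X) (psi : X -> 'rV[R]_p -> 'rV[R]_p)
    (Theta Pi : set 'rV[R]_p) (Phi : 'rV[R]_p -> 'rV[R]_p -> 'rV[R]_p)
    (u : forall n, {RV P >-> n.-tuple U}) (theta pi : 'rV[R]_p) :
  measurable_fun setT (g theta) -> vec_measurable (fun x => psi x pi) ->
  assumption_A P g psi F Theta Pi Phi -> has_law F u ->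
  Theta theta -> Pi pi ->
  Phin g psi theta (u x.1 x.2) pi @[x --> prob_near P] --> Phi theta pi.
Proof.
move=> mg mpsi [_ _ PhinPhi _] uF Ttheta Pipi.
suff : cvg_in_prob P (fun n w => Phin g psi theta (u n w) pi) (Phi theta pi).
  by move/cvg_in_probP; apply=> n; exact: vec_measurable_Phin.
exact: PhinPhi.
Qed.

Lemma pi_estimator_consistent (R : realType) (p : nat)
    (dO dU dX : measure_display)
    (Omega : measurableType dO) (U : measurableType dU) (X : measurableType dX)
    (P : probability Omega R) (F : forall n, probability (n.-tuple U) R)
    (g : 'rV[R]_p -> U -> X) (psi : X -> 'rV[R]_p -> 'rV[R]_p)
    (Theta Pi : set 'rV[R]_p) (Phi : 'rV[R]_p -> 'rV[R]_p -> 'rV[R]_p)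
    (u : forall n, {RV P >-> n.-tuple U}) (theta pi0 : 'rV[R]_p)
    (pihat : nat -> Omega -> 'rV[R]_p) :
  measurable_fun setT (g theta) ->
  (forall pi, Pi pi -> vec_measurable (fun x => psi x pi)) ->
  assumption_A P g psi F Theta Pi Phi -> has_law F u ->
  Theta theta -> zero_in Pi (Phi theta) pi0 ->
  pi_estimator g psi Pi theta u pihat ->
  pihat x.1 x.2 @[x --> prob_near P] --> pi0.
Proof.
move=> mg mpsi hA uF Ttheta [Pi0 Phi0] pihatP.
have [[_ cPi] lipA _ Phi_inj] := hA; have [A OA lip] := lipA _ Ttheta u uF.
have zero_pihat : prob_near P [set x : nat * Omega |
    zero_in Pi (Phin g psi theta (u x.1 x.2)) (pihat x.1 x.2)].
  apply: (@eventually_prob_near _ _ _ _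
    (fun n w => zero_in Pi (Phin g psi theta (u n w)) (pihat n w))).
  (* Sample size 0 is discarded, since the estimator has to be a zero only for positive [n]. *)
  by exists 1 => // n n0 w; apply (pihatP n).2.
apply: (@tight_lipschitz_zero_cvg _ _ _ _ _ _ _ _ (Phi theta)
  (fun x : nat * Omega => Phin g psi theta (u x.1 x.2))
  (fun x : nat * Omega => A x.1 x.2) _ cPi).
- by move=> pi Pipi Phipi; apply/(Phi_inj theta pi pi0) => //; rewrite Phipi.
- exact: Op1_tight.
- exact: (ae_prob_near lip).
- by move=> pi Pipi; exact: (Phin_cvg mg (mpsi _ Pipi) hA uF Ttheta Pipi).
- by move: zero_pihat; apply: filterS => x [].
- apply/cvgr0Pnorm_lt => e e0; move: zero_pihat; apply: filterS => x [_ ->].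
  by rewrite normr0.
Qed.

Lemma SwiZs_consistent_B (R : realType) (p : nat)
    (dO dU dX : measure_display)
    (Omega : measurableType dO) (U : measurableType dU) (X : measurableType dX)
    (P : probability Omega R) (F : forall n, probability (n.-tuple U) R)
    (g : 'rV[R]_p -> U -> X) (psi : X -> 'rV[R]_p -> 'rV[R]_p)
    (Theta Pi : set 'rV[R]_p) (Phi : 'rV[R]_p -> 'rV[R]_p -> 'rV[R]_p)
    (us : forall n, {RV P >-> n.-tuple U}) (theta0 pi0 : 'rV[R]_p)
    (pihat thetahat : nat -> Omega -> 'rV[R]_p) :
  (forall theta, Theta theta -> measurable_fun setT (g theta)) ->
  vec_measurable (fun x => psi x pi0) ->
  assumption_A P g psi F Theta Pi Phi -> assumption_B P g psi F Theta Pi Phi ->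
  has_law F us -> Theta theta0 -> zero_in Pi (Phi theta0) pi0 ->
  (\forall x \near prob_near P, Pi (pihat x.1 x.2)) ->
  pihat x.1 x.2 @[x --> prob_near P] --> pi0 ->
  SwiZs_estimator g psi Theta us pihat thetahat ->
  thetahat x.1 x.2 @[x --> prob_near P] --> theta0.
Proof.
move=> mg mpsi hA [lipB Phi_inj] usF Ttheta0 [Pi0 Phi0] Pihat pihat_cvg swizs.
have [[cTheta _] lipA _ _] := hA; have [B OB lip] := lipB us usF.
have zero_thetahat : prob_near P [set x : nat * Omega |
    zero_in Theta (fun theta => Phin g psi theta (us x.1 x.2) (pihat x.1 x.2))
      (thetahat x.1 x.2)].
  apply: (@eventually_prob_near _ _ _ _ (fun n w => zero_in Theta
    (fun theta => Phin g psi theta (us n w) (pihat n w)) (thetahat n w))).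
  by exists 1 => // n n0 w; apply (swizs n).2.
have {}lip : prob_near P [set x : nat * Omega | forall theta1 theta2 pi,
    Theta theta1 -> Theta theta2 -> Pi pi ->
    `|Phin g psi theta1 (us x.1 x.2) pi - Phin g psi theta2 (us x.1 x.2) pi|
      <= B x.1 x.2 * `|theta1 - theta2|].
  exact: (ae_prob_near lip).
apply: (@tight_lipschitz_zero_cvg _ _ _ _ _ _ _ _ (fun theta => Phi theta pi0)
  (fun (x : nat * Omega) theta => Phin g psi theta (us x.1 x.2) pi0)
  (fun x : nat * Omega => B x.1 x.2) _ cTheta).
- move=> theta Ttheta Phitheta.
  by apply/(Phi_inj theta theta0 pi0) => //; rewrite Phitheta.
- exact: Op1_tight.
- by move: lip; apply: filterS => x lipx *; exact: lipx.
- move=> theta Ttheta.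
  exact: (Phin_cvg (mg _ Ttheta) mpsi hA usF Ttheta Pi0).
- by move: zero_thetahat; apply: filterS => x [].
(* (A) provides a factor for each [theta] separately. Outside [Theta] the factor of [theta0] is a
   placeholder, so that choice applies to all vectors. *)
have /choice[A AP] : forall theta, exists A : nat -> {RV P >-> R},
    Theta theta -> Op1 A /\
    \forall n \near \oo, {ae P, forall w, forall pi1 pi2, Pi pi1 -> Pi pi2 ->
      `|Phin g psi theta (us n w) pi1 - Phin g psi theta (us n w) pi2|
        <= A n w * `|pi1 - pi2|}.
  move=> theta.
  have [/lipA/(_ us usF)[A]|nT] := pselect (Theta theta); first by exists A.
  by have [A] := lipA _ Ttheta0 us usF; exists A.
apply/cvgr0Pnorm_lt => e e0.
have tA theta : Theta theta ->
    tight (prob_near P) (fun x : nat * Omega => A theta x.1 x.2).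
  by move=> /AP[OA _]; exact: Op1_tight.
have lipA' theta : Theta theta ->
    prob_near P [set x : nat * Omega | forall pi1 pi2,
    Pi pi1 -> Pi pi2 ->
    `|Phin g psi theta (us x.1 x.2) pi1 - Phin g psi theta (us x.1 x.2) pi2|
      <= A theta x.1 x.2 * `|pi1 - pi2|].
  by move=> /AP[_]; exact: ae_prob_near.
(* Uniformity over [Theta] allows the random point [thetahat] to be inserted. There $\Phi_n(\cdot,
   u_s, \hat\pi_n)$ vanishes, so the difference is minus the value at [pi0]. *)
have unif := tight_lipschitz_cvg_uniform (FF := prob_near_filter P)
  (H := fun (x : nat * Omega) theta pi => Phin g psi theta (us x.1 x.2) pi)
  cTheta tA (Op1_tight OB) lipA' lip Pi0 Pihat pihat_cvg e0.
move: zero_thetahat unif; apply: filterS2 => x [Tth Phith] /(_ _ Tth).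
by rewrite Phith sub0r normrN.
Qed.

(** Apart from lying in [Theta], [thetahat] enters only through the identity
    [piII n (thetahat n w) w = pihat n w], so the result serves both kinds of estimator. *)
Lemma II_consistent_C (R : realType) (p : nat) (dO : measure_display)
    (Omega : measurableType dO) (P : probability Omega R)
    (Theta : set 'rV[R]_p) (pimap : 'rV[R]_p -> 'rV[R]_p) (theta0 : 'rV[R]_p)
    (pihat thetahat : nat -> Omega -> 'rV[R]_p)
    (piII : nat -> 'rV[R]_p -> Omega -> 'rV[R]_p) :
  compact Theta -> Theta theta0 -> assumption_C P Theta pimap piII ->
  (forall theta, Theta theta ->
     piII x.1 theta x.2 @[x --> prob_near P] --> pimap theta) ->
  pihat x.1 x.2 @[x --> prob_near P] --> pimap theta0 ->
  (forall n, (0 < n)%N -> forall w, Theta (thetahat n w) /\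
     piII n (thetahat n w) w = pihat n w) ->
  thetahat x.1 x.2 @[x --> prob_near P] --> theta0.
Proof.
move=> cTheta Ttheta0 [[C OC lip] pimap_inj] piII_cvg pihat_cvg thetahatP.
have {}thetahatP : \forall x \near prob_near P, Theta (thetahat x.1 x.2) /\
    piII x.1 (thetahat x.1 x.2) x.2 = pihat x.1 x.2.
  apply: (@eventually_prob_near _ _ _ _ (fun n w => Theta (thetahat n w) /\
    piII n (thetahat n w) w = pihat n w)).
  by exists 1 => // n n0 w; exact: thetahatP.
apply: (@tight_lipschitz_zero_cvg _ _ _ _ _ _ _ _
  (fun theta => pimap theta - pimap theta0)
  (fun (x : nat * Omega) theta => piII x.1 theta x.2 - pimap theta0)
  (fun x : nat * Omega => C x.1 x.2) _ cTheta).
- by move=> theta Ttheta /subr0_eq/pimap_inj; exact.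
- exact: Op1_tight.
- have := ae_prob_near lip.
  apply: filterS => x lipx theta1 theta2 T1 T2.
  by rewrite opprB addrA subrK; exact: lipx.
- by move=> theta Ttheta; apply: cvgB; [exact: piII_cvg | exact: cvg_cst].
- by move: thetahatP; apply: filterS => x [].
(* At [thetahat] the centred map takes the value [pihat - pimap theta0], which tends to 0. *)
have /subr_cvg0/cvgr0Pnorm_lt pihat0 := pihat_cvg.
apply/cvgr0Pnorm_lt => e e0.
by move: thetahatP (pihat0 e e0); apply: filterS2 => x [_ ->].
Qed.

(* The family of zeros that (C) is applied to for the SwiZs estimator: it passes
   through pihat at thetahat. *)
Lemma piII_estimator_patch (R : realType) (p : nat) (dO dU : measure_display)
    (Omega : measurableType dO) (U : measurableType dU) (X : Type)
    (P : probability Omega R)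
    (g : 'rV[R]_p -> U -> X) (psi : X -> 'rV[R]_p -> 'rV[R]_p)
    (Theta Pi : set 'rV[R]_p) (us : forall n, {RV P >-> n.-tuple U})
    (pihat thetahat : nat -> Omega -> 'rV[R]_p)
    (piII : nat -> 'rV[R]_p -> Omega -> 'rV[R]_p) :
  (forall n, vec_measurable (pihat n)) ->
  (forall n, (0 < n)%N -> forall w, Pi (pihat n w)) ->
  piII_estimator g psi Theta Pi us piII ->
  SwiZs_estimator g psi Theta us pihat thetahat ->
  piII_estimator g psi Theta Pi us (fun n theta w =>
    if thetahat n w == theta then pihat n w else piII n theta w).
Proof.
move=> mpihat Pihat piIIP swizs theta Ttheta n; split=> [i|n0 w].
  have meq : measurable_fun setT (fun w => thetahat n w == theta).
    under eq_fun do rewrite -subr_eq0 -normr_eq0.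
    apply: measurable_realfun.measurable_fun_eqr; last exact: measurable_cst.
    exact/vec_measurable_norm/vec_measurable_subC/(swizs n).1.
  under eq_fun do rewrite (fun_if (fun v : 'rV[R]_p => v ord0 i)).
  apply: measurable_fun_ifT => //; first exact: mpihat.
  exact: (piIIP _ Ttheta n).1.
(* Where [thetahat = theta], the SwiZs equation says precisely that [pihat] is a zero of
   $\Phi_n(\theta, u_s, \cdot)$. *)
case: eqP => [<-|_]; last exact: (piIIP _ Ttheta n).2.
by split; [exact: Pihat | exact: ((swizs n).2 n0 w).2].
Qed.

(* In (2), the SwiZs estimator does not refer to one particular family of zeros
   hat pi_{II,n}, so for it (C) is asked of every such family (one and the same
   condition when the zeros in pi are unique); for the indirect inference
   estimator (C) is asked of the family it is built from. *)
Theorem theorem34 (R : realType) (p : nat)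
    (dO dU dX : measure_display) (Omega : measurableType dO)
    (U : measurableType dU) (X : measurableType dX)
    (P : probability Omega R)
    (F : forall n : nat, probability (n.-tuple U) R)
    (g : 'rV[R]_p -> U -> X) (psi : X -> 'rV[R]_p -> 'rV[R]_p)
    (Theta Pi : set 'rV[R]_p)
    (Phi : 'rV[R]_p -> 'rV[R]_p -> 'rV[R]_p)
    (pimap : 'rV[R]_p -> 'rV[R]_p) (theta0 : 'rV[R]_p)
    (u0 us : forall n : nat, {RV P >-> n.-tuple U})
    (d : 'rV[R]_p -> 'rV[R]_p -> R)
    (g_meas : forall theta, Theta theta -> measurable_fun setT (g theta))
    (psi_meas : forall pi, Pi pi -> vec_measurable (fun x => psi x pi))
    (u0_law : has_law F u0) (us_law : has_law F us)
    (theta0_in : Theta theta0)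
    (pimapP : forall theta, Theta theta ->
       zero_in Pi (Phi theta) (pimap theta))
    (d_metric : is_metric d)
    (hA : assumption_A P g psi F Theta Pi Phi) :
  (* 1 *)
  ((forall pihat : nat -> Omega -> 'rV[R]_p,
      pi_estimator g psi Pi theta0 u0 pihat ->
      cvg_in_prob P pihat (pimap theta0)) /\
   (forall theta, Theta theta -> forall pihatII : nat -> Omega -> 'rV[R]_p,
      pi_estimator g psi Pi theta us pihatII ->
      cvg_in_prob P pihatII (pimap theta))) /\
  (* 2 *)
  (forall (pihat : nat -> Omega -> 'rV[R]_p)
      (piII : nat -> 'rV[R]_p -> Omega -> 'rV[R]_p)
      (thetahat : nat -> Omega -> 'rV[R]_p),
    pi_estimator g psi Pi theta0 u0 pihat ->
    piII_estimator g psi Theta Pi us piII ->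
    (SwiZs_estimator g psi Theta us pihat thetahat ->
     assumption_B P g psi F Theta Pi Phi \/
     (forall piII' : nat -> 'rV[R]_p -> Omega -> 'rV[R]_p,
        piII_estimator g psi Theta Pi us piII' ->
        assumption_C P Theta pimap piII') ->
     cvg_in_prob P thetahat theta0) /\
    (II_estimator Theta d pihat piII thetahat ->
     assumption_B P g psi F Theta Pi Phi \/
     assumption_C P Theta pimap piII ->
     cvg_in_prob P thetahat theta0)).
Proof.
have consistent_A (u : forall n, {RV P >-> n.-tuple U}) theta
    (pihat : nat -> Omega -> 'rV[R]_p) : has_law F u -> Theta theta ->
    pi_estimator g psi Pi theta u pihat ->
    pihat x.1 x.2 @[x --> prob_near P] --> pimap theta.
  move=> uF Ttheta.
  exact: (pi_estimator_consistent (g_meas _ Ttheta) psi_meas hA uF Ttheta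
    (pimapP _ Ttheta)).
have [[cTheta _] _ _ _] := hA; have [_ d_eq0 _ _] := d_metric.
split; first split.
- move=> pihat pihatP; apply/cvg_in_probP => [n|]; first exact: (pihatP n).1.
  exact: (consistent_A u0).
- move=> theta Ttheta pihat pihatP; apply/cvg_in_probP => [n|].
    exact: (pihatP n).1.
  exact: (consistent_A us).
move=> pihat piII thetahat pihatP piIIP.
have pihat_cvg := consistent_A u0 theta0 pihat u0_law theta0_in pihatP.
have Pihat n : (0 < n)%N -> forall w, Pi (pihat n w).
  by move=> n0 w; exact: ((pihatP n).2 n0 w).1.
have consistent_B : SwiZs_estimator g psi Theta us pihat thetahat ->
    assumption_B P g psi F Theta Pi Phi -> cvg_in_prob P thetahat theta0.
  move=> swizs hB; apply/cvg_in_probP => [n|]; first exact: (swizs n).1.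
  apply: (SwiZs_consistent_B g_meas _ hA hB us_law theta0_in
    (pimapP _ theta0_in) _ pihat_cvg swizs).
    by apply: psi_meas; exact: (pimapP _ theta0_in).1.
  apply: (@eventually_prob_near _ _ _ _ (fun n w => Pi (pihat n w))).
  by exists 1 => // n n0; exact: Pihat.
have consistent_C piII' : piII_estimator g psi Theta Pi us piII' ->
    assumption_C P Theta pimap piII' ->
    (forall n, vec_measurable (thetahat n)) ->
    (forall n, (0 < n)%N -> forall w, Theta (thetahat n w) /\
      piII' n (thetahat n w) w = pihat n w) ->
    cvg_in_prob P thetahat theta0.
  move=> piIIP' hC mth thetahatP; apply/cvg_in_probP => //.
  apply: (II_consistent_C cTheta theta0_in hC _ pihat_cvg thetahatP).
  move=> theta Ttheta.
  exact: (consistent_A us theta (fun n => piII' n theta) us_law Ttheta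
    (piIIP' _ Ttheta)).
split=> [swizs [|hC]|II_thetahat [hB|hC]].
- exact: consistent_B.
(* (C) is used for the patched family, whose value at [thetahat] is [pihat] by construction. *)
- have patchP := piII_estimator_patch (fun n => (pihatP n).1) Pihat piIIP swizs.
  apply: (consistent_C _ patchP (hC _ patchP)) => [n|n n0 w].
    exact: (swizs n).1.
  by rewrite eqxx; split=> //; exact: ((swizs n).2 n0 w).1.
(* A metric vanishes only on the diagonal, so [pihat] is the value of [piII] at [thetahat]. Hence an
   indirect inference estimator also solves the SwiZs equation, and the argument under (B)
   applies. *)
- apply: consistent_B hB => n; split=> [|n0 w]; first exact: (II_thetahat n).1.
  have [Tth /d_eq0 ->] := (II_thetahat n).2 n0 w.
  by split=> //; exact: ((piIIP _ Tth n).2 n0 w).2.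
- apply: (consistent_C piII) => // [n|n n0 w]; first exact: (II_thetahat n).1.
  by have [Tth /d_eq0 ->] := (II_thetahat n).2 n0 w.
Qed.
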